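(* Let $\mathbb{F}$ be a field of characteristic $0$, let $\mathbb{V}$ be an $n$-dimensional vector space over $\mathbb{F}$ ($n\ge 1$) with a basis $b_1,\dots,b_n$, and let $(\cdot,\cdot)$ be the symmetric bilinear form on $\mathbb{V}$ with $(b_i,b_j)=\delta_{ij}$. Let $\mathbb{A}$ be the ternary algebra on $\mathbb{V}$ with product $[x,y,z]=(y,z)x+(x,z)y+(x,y)z$. Then all degree $1$ identities on $\mathbb{A}$ are a consequence of the total commutativity of the product.
   Context: A degree $1$ identity on $\mathbb{A}$ is an identity of the form $\sum_{\sigma\in S_3}\alpha_\sigma[x_{\sigma(1)},x_{\sigma(2)},x_{\sigma(3)}]=0$ with $\alpha_\sigma\in\mathbb{F}$, holding for all $x_1,x_2,x_3\in\mathbb{A}$. Total commutativity is the set of identities $[x_{\sigma(1)},x_{\sigma(2)},x_{\sigma(3)}]=[x_1,x_2,x_3]$, $\sigma\in S_3$. A degree $1$ identity is a consequence of total commutativity if its formal left-hand side (in the vector space with basis the six formal monomials $[x_{\sigma(1)},x_{\sigma(2)},x_{\sigma(3)}]$) is a linear combination of the formal differences $[x_{\sigma(1)},x_{\sigma(2)},x_{\sigma(3)}]-[x_1,x_2,x_3]$. *)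

(* Defs.v *)
From mathcomp Require Export all_boot all_order all_fingroup all_algebra.
From mathcomp Require Export sesquilinear.

Set Implicit Arguments.
Unset Strict Implicit.
Unset Printing Implicit Defensive.

Import GRing.Theory.
Local Open Scope ring_scope.

Definition sym_form_product (F : fieldType) (V : vectType F)
    (form : {symmetric V}) (x y z : V) : V :=
  form y z *: x + form x z *: y + form x y *: z.

(* The six-dimensional space of formal combinations of the monomials
   [x_(s 0), x_(s 1), x_(s 2)], s in 'S_3; f s is the coefficient of the
   monomial attached to s. The scalars are written F^o so that the function
   type gets its vector space structure. *)
Notation formal3 F := {ffun 'S_3 -> F^o}.

Definition formal_monomial (F : fieldType) (s : 'S_3) : formal3 F :=
  [ffun t => (t == s)%:R].

Definition formal_eval (F : fieldType) (V : lmodType F)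
    (prod3 : V -> V -> V -> V) (f : formal3 F) (x : 'I_3 -> V) : V :=
  \sum_(s : 'S_3) f s *: prod3 (x (s 0)) (x (s 1)) (x (s 2)).

Definition degree1_identity (F : fieldType) (V : lmodType F)
    (prod3 : V -> V -> V -> V) (f : formal3 F) : Prop :=
  forall x : 'I_3 -> V, formal_eval prod3 f x = 0.

Definition consequence_of_total_commutativity (F : fieldType)
    (f : formal3 F) : Prop :=
  f \in <<[seq formal_monomial F s - formal_monomial F 1%g | s : 'S_3]>>%VS.

(* Main.v *)
Require Import Defs.

(** Evaluating an identity with all three variables equal to one vector [v]
    collapses the six monomials to the same vector [[v, v, v] = 3 (v, v) v],
    which is nonzero for [v] a vector of the orthonormal basis, as the
    characteristic is not 3. Hence the coefficients of a degree 1 identity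
    sum to 0. That single linear condition already cuts out the span of the
    differences of monomials: a formal combination [f] equals the sum of the
    [f s *: (m_s - m_1)] plus its coefficient sum times [m_1]. *)

Set Implicit Arguments.
Unset Strict Implicit.
Unset Printing Implicit Defensive.

Import GRing.Theory.
Local Open Scope ring_scope.

Lemma formal_eval_const (F : fieldType) (V : lmodType F)
    (prod3 : V -> V -> V -> V) (f : formal3 F) (v : V) :
  formal_eval prod3 f (fun=> v) = (\sum_s f s : F) *: prod3 v v v.
Proof. by rewrite /formal_eval -scaler_suml. Qed.

Lemma sym_form_product_diag (F : fieldType) (V : vectType F)
    (form : {symmetric V}) (v : V) :
  sym_form_product form v v v = (form v v *+ 3) *: v.
Proof. by rewrite /sym_form_product -!scalerDl !mulrS mulr0n addr0 addrA. Qed.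

Lemma formal_monomial_expansion (F : fieldType) (f : formal3 F) :
  f = \sum_s (f s : F) *: formal_monomial F s.
Proof.
apply/ffunP => t; rewrite sum_ffunE (bigD1 t) //= big1 => [|s s_neq_t].
  by rewrite !ffunE eqxx addr0 [LHS](esym (mulr1 _)).
by rewrite !ffunE eq_sym (negPf s_neq_t) scaler0.
Qed.

(** The multiples of [m_1] subtracted in the differences add up to the
    coefficient sum times [m_1], so they may be subtracted for free when
    that sum is 0. *)
Lemma consequence_of_sum0 (F : fieldType) (f : formal3 F) :
  \sum_s f s = 0 -> consequence_of_total_commutativity f.
Proof.
move=> sum_f; rewrite /consequence_of_total_commutativity.
have -> : f = \sum_s (f s : F) *: (formal_monomial F s - formal_monomial F 1%g).
  under eq_bigr do rewrite scalerBr.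
  rewrite sumrB -formal_monomial_expansion -scaler_suml.
  by rewrite [X in X *: _]sum_f scale0r subr0.
by apply: memv_suml => s _; apply/memvZ/memv_span/image_f.
Qed.

Theorem lemma8 (F : fieldType) (char0 : [pchar F] =i pred0)
    (V : vectType F) (n : nat) (n_ge1 : (1 <= n)%N)
    (b : n.-tuple V) (basis_b : basis_of fullv b)
    (form : {symmetric V})
    (form_b : forall i j : 'I_n, form (tnth b i) (tnth b j) = (i == j)%:R)
    (f : formal3 F) :
  degree1_identity (sym_form_product form) f ->
  consequence_of_total_commutativity f.
Proof.
move=> f_id; apply: consequence_of_sum0.
pose i0 : 'I_n := Ordinal n_ge1.
have b0_neq0 : tnth b i0 != 0.
  exact: free_not0 (basis_free basis_b) (mem_tnth i0 b).
have three_neq0 : 3%:R != 0 :> F by rewrite ((pcharf0P F).1 char0).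
have := f_id (fun=> tnth b i0).
rewrite formal_eval_const sym_form_product_diag form_b eqxx => /eqP.
by rewrite !scaler_eq0 (negPf b0_neq0) (negPf three_neq0) !orbF => /eqP.
Qed.
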